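(* Let $\mathbb{F}$ be a field of positive odd characteristic $p$. Let $n\geq 1$ be an integer and let $A\in \mathbb{M}_n(\mathbb{F})$ be a nonderogatory matrix such that $\mathrm{Tr}(A)=t\cdot 1_{\mathbb{F}}$ for some $t\in\{0,1,\dots,p-1\}$. Then there exist matrices $E,V\in\mathbb{M}_n(\mathbb{F})$ such that $A=E+V$, $E^p=E$ and $V^3=0$.
   Context: $\mathbb{M}_n(\mathbb{F})$ denotes the ring of $n\times n$ matrices over $\mathbb{F}$, $\mathrm{Tr}$ is the trace, and $1_{\mathbb{F}}$ is the unity of $\mathbb{F}$. A square matrix is nonderogatory if its characteristic and minimal polynomials coincide. *)

(* Defs.v *)
From HB Require Import structures.
From mathcomp Require Import all_boot all_order all_algebra.
Set Implicit Arguments.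
Unset Strict Implicit.
Unset Printing Implicit Defensive.
Import GRing.Theory.
Local Open Scope ring_scope.

(* The size is m.+1 because [mxminpoly] is only defined for nonempty square
   matrices. Both polynomials are monic, so Leibniz equality is the right
   comparison. *)
Definition nonderogatory (F : fieldType) (m : nat) (A : 'M[F]_m.+1) : Prop :=
  char_poly A = mxminpoly A.

(* Main.v *)
(* Over the row basis v b_m(A), ..., v b_1(A), v, where v is a cyclic vector and
   b_k is a product of k linear factors X - d_i, the matrix A becomes
   subdiagonal ones, diagonal entries d_i (an arbitrary sequence with sum tr A),
   and one arbitrary full row 0. Give V the subdiagonal entries in the rows i
   with 3 not dividing i: no three of them are consecutive, so V^3 = 0. The rest
   is E = lam + E0, where column 0 of E0 vanishes and, below row 0, E0 is block
   diagonal with blocks of size at most 2. If the diagonal of E0 consists of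
   nonzero elements e_i of the prime field, opposite to each other in each
   block of size 2, then E0^2 acts on row vectors as e_i^2 on the i-th one
   (i > 0), so E0^p = E0, and E^p = E by Frobenius. The trace fixes e_1, so it
   remains to have two choices of (lam, (e_i)_(i > 1)) with different traces,
   at most one of which forces e_1 = 0: if p does not divide the size of A, take
   lam = 0 and lam = 1; otherwise flip the sign of one e_i outside the blocks of
   size 2, which exists because the size is then 3 or at least 5. *)
From Stdlib Require Import Classical.
Require Import Defs.
From mathcomp Require Import all_boot all_order all_algebra.
From mathcomp Require Import zify ring.
Set Implicit Arguments.
Unset Strict Implicit.
Unset Printing Implicit Defensive.
Import GRing.Theory.
Local Open Scope ring_scope.

(** * Orders of row vectors and existence of a cyclic vector *)

Lemma irreducible_factor (F : fieldType) (f : {poly F}) :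
  (1 < size f)%N -> exists2 q, irreducible_poly q & q %| f.
Proof.
have [n] := ubnP (size f); elim: n f => // n IHn f lefn sf.
(* Irreducibility over an arbitrary field need not be decidable, hence the classical case split. *)
have [irr_f | nirr_f] := classic (irreducible_poly f); first by exists f.
have [g [sg gf ngf]] : exists g : {poly F},
    [/\ size g != 1, g %| f & ~~ (g %= f)].
  apply: NNPP => noex; apply: nirr_f; split=> // g sg gf.
  by apply/negPn/negP => ngf; apply: noex; exists g.
have f0 : f != 0 by rewrite -size_poly_gt0; lia.
have g0 : g != 0 by apply: contraNneq f0 => g0; rewrite -dvd0p -g0.
have ltgf : (size g < size f)%N.
  by rewrite ltn_neqAle dvdp_leq // andbT (dvdp_size_eqp gf).
have [||q irr_q qg] := IHn g; first by lia.
- by rewrite ltn_neqAle eq_sym sg size_poly_gt0.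
by exists q => //; apply: dvdp_trans gf.
Qed.

Lemma factor_out_power (F : fieldType) (q f : {poly F}) :
  (1 < size q)%N -> f != 0 -> exists k h, f = q ^+ k * h /\ ~~ (q %| h).
Proof.
move=> sq; have [n] := ubnP (size f); elim: n f => // n IHn f lefn f0.
have [/dvdpP[g Df] | nqf] := boolP (q %| f); last by exists 0, f; rewrite mul1r.
have q0 : q != 0 by rewrite -size_poly_gt0; lia.
have g0 : g != 0 by apply: contraNneq f0 => g0; rewrite Df g0 mul0r.
have [||k [h [Dg nqh]]] := IHn g => //.
  move: sq lefn; rewrite Df size_mul //.
  by set a := size q; set b := size g; lia.
by exists k.+1, h; split=> //; rewrite Df Dg mulrC exprS mulrA.
Qed.

Lemma horner_mxM_row (F : fieldType) (m : nat) (A : 'M[F]_m.+1)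
    (v : 'rV_m.+1) (f g : {poly F}) :
  v *m horner_mx A (f * g) = v *m horner_mx A f *m horner_mx A g.
Proof. by rewrite rmorphM /= -mulmxA. Qed.

Lemma coprime_annihilators (F : fieldType) (m : nat) (A : 'M[F]_m.+1)
    (v : 'rV_m.+1) (f g : {poly F}) :
    coprimep f g ->
  v *m horner_mx A f = 0 -> v *m horner_mx A g = 0 -> v = 0.
Proof.
move=> /Bezout_eq1_coprimepP[[a b] /= ab1] vf vg.
have <- : v *m horner_mx A 1 = v by rewrite rmorph1 mulmx1.
rewrite -ab1 mulrC [b * g]mulrC.
by rewrite rmorphD mulmxDr /= !horner_mxM_row vf vg !mul0mx addr0.
Qed.

(** Write [g] as [q ^+ j * h] with [q] not dividing [h]. If [j <= k], then
    [v *m horner_mx A (q ^+ j)] is killed by the coprime polynomials [h] and [q ^+ k.+1], so it is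
    zero, against the third hypothesis. *)
Lemma annihilator_prime_power (F : fieldType) (m : nat) (A : 'M[F]_m.+1)
    (v : 'rV_m.+1) (q g : {poly F}) (k : nat) :
    irreducible_poly q -> v *m horner_mx A (q ^+ k.+1) = 0 ->
    v *m horner_mx A (q ^+ k) != 0 ->
  v *m horner_mx A g = 0 -> q ^+ k.+1 %| g.
Proof.
move=> irr_q vq1 vq vg.
have [-> | g0] := eqVneq g 0; first exact: dvdp0.
have [j [h [Dg nqh]]] := factor_out_power irr_q.1 g0.
have [ltkj | lejk] := ltnP k j.
  by rewrite Dg; apply/dvdp_mulr/dvdp_exp2l.
case/eqP: vq; rewrite -(subnKC lejk) exprD horner_mxM_row.
suff -> : v *m horner_mx A (q ^+ j) = 0 by rewrite mul0mx.
apply: (@coprime_annihilators _ _ A _ h (q ^+ k.+1)).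
- by rewrite coprimep_sym coprimep_expl // irreducible_poly_coprime.
- by rewrite -horner_mxM_row -Dg.
by rewrite -horner_mxM_row mulrC horner_mxM_row vq1 mul0mx.
Qed.

(** Coprime orders multiply under addition of vectors: split off a full prime power of [f], and add
    a vector of that order to one obtained by induction for the cofactor. For [f = mxminpoly A] and
    [A] nonderogatory, [v] is a cyclic vector. *)
Lemma vector_of_order (F : fieldType) (m : nat) (A : 'M[F]_m.+1)
    (f : {poly F}) :
    f %| mxminpoly A ->
  exists v : 'rV_m.+1, forall g, (v *m horner_mx A g == 0) = (f %| g).
Proof.
have M0 : mxminpoly A != 0 := monic_neq0 (mxminpoly_monic A).
have [n] := ubnP (size f); elim: n f => // n IHn f lefn fM.
have f0 : f != 0 by apply: contraNneq M0 => f0; rewrite -dvd0p -f0.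
have [sf1 | sf] := leqP (size f) 1.
  exists 0 => g; rewrite mul0mx eqxx dvdUp //.
  by rewrite -size_poly_eq1 eqn_leq sf1 size_poly_gt0.
have [q irr_q qf] := irreducible_factor sf.
have [[|k] [h [Df nqh]]] := factor_out_power irr_q.1 f0.
  by rewrite Df mul1r (negPf nqh) in qf.
have q0 := irredp_neq0 irr_q.
have h0 : h != 0 by apply: contraNneq nqh => ->; rewrite dvdp0.
have sqk : (0 < size (q ^+ k))%N by rewrite size_poly_gt0 expf_neq0.
have hf : h %| f by rewrite Df dvdp_mull.
have cqh : coprimep (q ^+ k.+1) h.
  by rewrite coprimep_expl // irreducible_poly_coprime.
have [||v vP] := IHn h.
- move: lefn irr_q.1 sqk.
  rewrite Df exprS -mulrA !size_mul ?mulf_neq0 ?expf_neq0 //.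
  set a := size q; set b := size h; set d := size (q ^+ k); lia.
- exact: dvdp_trans fM.
have vh : v *m horner_mx A h = 0 by apply/eqP; rewrite vP.
have [c DM] := dvdpP _ _ fM.
(* The product [c * h * q ^+ k] is a proper divisor of the minimal polynomial, so it does not
   annihilate [A]. *)
have [u uN0] : exists u : 'rV_m.+1, u *m horner_mx A (c * h * q ^+ k) != 0.
  have: horner_mx A (c * h * q ^+ k) != 0.
    have c0 : c != 0 by apply: contraNneq M0 => c0; rewrite DM c0 mul0r.
    rewrite -dvd_mxminpoly; apply/negP => /dvdp_leq.
    rewrite !mulf_neq0 ?expf_neq0 // => /(_ isT).
    have -> : mxminpoly A = (c * h * q ^+ k * q)%R.
      by rewrite DM Df exprSr; ring.
    rewrite [size (_ * q)%R]size_mul ?mulf_neq0 ?expf_neq0 //.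
    have : (0 < size (c * h * q ^+ k)%R)%N.
      by rewrite size_poly_gt0 !mulf_neq0 ?expf_neq0.
    by move: irr_q.1; set a := size q; set b := size _; lia.
  case/rowV0Pn => w /submxP[u ->] uN0; by exists u.
pose w := u *m horner_mx A (c * h).
have wq : w *m horner_mx A (q ^+ k.+1) = 0.
  rewrite -horner_mxM_row (_ : _ * _ = mxminpoly A).
    by rewrite mx_root_minpoly mulmx0.
  by rewrite DM Df -mulrA [h * _]mulrC.
have wP g : w *m horner_mx A g = 0 -> q ^+ k.+1 %| g.
  by apply: annihilator_prime_power => //; rewrite -horner_mxM_row.
exists (v + w) => g; apply/eqP/idP => [vwg | /dvdpP[b ->]]; last first.
  rewrite Df mulmxDl mulrCA horner_mxM_row mulrC.
  rewrite [w *m _]horner_mxM_row wq mul0mx addr0.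
  rewrite -horner_mxM_row mulrCA horner_mxM_row mulrC horner_mxM_row.
  by rewrite vh !mul0mx.
(* Applying [h] to the relation kills the [v] part, and applying [q ^+ k.+1] kills the [w] part;
   coprimality then removes the extra factor. *)
rewrite Df Gauss_dvdp //; apply/andP; split.
  rewrite -(Gauss_dvdpl _ cqh); apply: wP.
  have := congr1 (mulmx^~ (horner_mx A h)) vwg.
  rewrite -horner_mxM_row mulmxDl mul0mx mulrC horner_mxM_row.
  by rewrite vh mul0mx add0r.
rewrite -(@Gauss_dvdpl _ g (q ^+ k.+1) h) 1?coprimep_sym // -vP.
have := congr1 (mulmx^~ (horner_mx A (q ^+ k.+1))) vwg.
rewrite -horner_mxM_row mulmxDl mul0mx [in w *m _]mulrC.
by rewrite [w *m _]horner_mxM_row wq mul0mx addr0 => ->.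
Qed.

(** * Hessenberg form with prescribed diagonal *)

Lemma graded_polys_free (F : fieldType) (b : nat -> {poly F}) (n : nat)
    (c : nat -> F) :
    (forall k, size (b k) = k.+1) -> \sum_(k < n) c k *: b k = 0 ->
  forall k, (k < n)%N -> c k = 0.
Proof.
move=> sb; elim: n => // n IHn; rewrite big_ord_recr /= => sum0.
have cn0 : c n = 0.
  have /(congr1 (fun p : {poly F} => p`_n)) := sum0.
  rewrite coefD coef_sum big1 => [|i _]; last first.
    by rewrite coefZ nth_default ?mulr0 // sb.
  rewrite add0r coefZ coef0 => /eqP; rewrite mulf_eq0 => /orP[/eqP // |].
  have := lead_coef_eq0 (b n).
  by rewrite lead_coefE sb /= => ->; rewrite -size_poly_eq0 sb.
move: sum0; rewrite cn0 scale0r addr0 => /IHn ck0 k.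
by rewrite ltnS leq_eqVlt => /orP[/eqP -> | /ck0].
Qed.

Lemma nonderogatory_hessenberg (F : fieldType) (m : nat) (A : 'M[F]_m.+1)
    (d : nat -> F) :
    nonderogatory A -> \sum_(j < m.+1) d j = \tr A ->
  exists2 P : 'M[F]_m.+1, P \in unitmx &
    let H := P *m A *m invmx P in
    H ord0 ord0 = d 0 /\
    forall i j : 'I_m.+1, (0 < i)%N ->
      H i j = d i *+ (j == i) + (j.+1 == i)%:R.
Proof.
move=> hA trd; have [v vP] := vector_of_order (dvdpp (mxminpoly A)).
(* The indices of [d] run downwards from [m], so that row [i.-1] of [P] is row [i] times [A - d i].
   Since [d 0] does not occur in [P], the trace has to supply it. *)
pose b k : {poly F} := \prod_(i < k) ('X - (d (m - i)%N)%:P).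
have sb k : size (b k) = k.+1.
  by rewrite /b size_prod_XsubC /index_enum -enumT size_enum_ord.
pose P : 'M_m.+1 := \matrix_(j < m.+1) (v *m horner_mx A (b (m - j)%N)).
have uP : P \in unitmx.
  rewrite -row_free_unit; apply: inj_row_free => w wP0.
  (* A dependency between the rows of [P] is a polynomial of degree at most [m] that kills the
     cyclic vector; the characteristic polynomial, of degree [m.+1], divides it. *)
  have : \sum_(k < m.+1) w 0 (inord (m - k)) *: b k = 0.
    set Q := \sum_(k < _) _.
    have : char_poly A %| Q.
      rewrite hA -vP; apply/eqP; rewrite -[RHS]wP0 [RHS]mulmx_sum_row.
      rewrite [RHS](reindex_inj rev_ord_inj) /= /Q rmorph_sum mulmx_sumr.
      apply: eq_bigr => k _; rewrite /= horner_mxZ -scalemxAr rowK.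
      have lek : (k <= m)%N by rewrite -ltnS.
      rewrite /= subSS subKn //; congr (w 0 _ *: _).
      by apply: val_inj; rewrite /= inordK ?subSS // ltnS leq_subr.
    have sQ : (size Q <= m.+1)%N.
      apply: leq_trans (size_sum _ _ _) _; apply/bigmax_leqP => k _.
      by apply: leq_trans (size_scale_leq _ _) _; rewrite sb.
    have [// | Q0 /(dvdp_leq Q0)] := eqVneq Q 0.
    by rewrite size_char_poly ltnNge sQ.
  move=> /(@graded_polys_free _ b _ (fun k => w 0 (inord (m - k))) sb) w0.
  apply/rowP => j; rewrite mxE -(w0 (m - j)%N) ?ltnS ?leq_subr //.
  by congr (w 0 _); apply: val_inj; rewrite /= inordK subKn // -ltnS.
exists P => // H.
have Hi (i j : 'I_m.+1) : (0 < i)%N -> H i j = d i *+ (j == i) + (j.+1 == i)%:R.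
  move=> i0; have lei : (i <= m)%N by rewrite -ltnS.
  pose i1 : 'I_m.+1 := inord i.-1.
  have Di1 : i1 = i.-1 :> nat by rewrite inordK // prednK // ltnW.
  have : row i (P *m A) = row i1 P + d i *: row i P.
    rewrite row_mul !rowK Di1.
    rewrite (_ : m - i.-1 = (m - i).+1)%N; last by lia.
    rewrite /b big_ord_recr /= -/(b _) subKn //.
    rewrite horner_mxM_row rmorphB /= horner_mx_X horner_mx_C mulmxBr.
    by rewrite mul_mx_scalar subrK.
  move/(congr1 (mulmx^~ (invmx P))).
  rewrite -row_mul mulmxDl -scalemxAl -!row_mul mulmxV // => /rowP/(_ j).
  rewrite !mxE -/H => ->.
  rewrite addrC mulr_natr ![_ == j]eq_sym; congr (_ + _%:R).
  by rewrite -val_eqE /= Di1 -eqSS prednK.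
split=> //; have : \tr H = \tr A.
  by rewrite mxtrace_mulC mulmxA mulVmx // mul1mx.
rewrite -trd /mxtrace !big_ord_recl /=.
rewrite (eq_bigr (fun i : 'I_m => d (bump 0 i))) => [/addIr // | i _].
by rewrite Hi // eqxx mulr1n -[X in _ + X]/(_%:R) gtn_eqF ?addr0.
Qed.

(** * Powers of the two summands *)

Lemma bidiagonal_expr (F : fieldType) (m k : nat) (E : 'M[F]_m.+1)
    (e : nat -> F) :
    (forall i, E i ord0 = 0) ->
    (forall i j : 'I_m.+1, (0 < i)%N ->
      E i j = e i *+ (j == i) + ((j.+1 == i) && (3 %| i)%N)%:R) ->
    (forall i, (0 < i <= m)%N -> e i ^+ k.*2 = 1) ->
    (forall i, (0 < i <= m)%N -> (3 %| i)%N -> e i = - e i.-1) ->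
  E ^+ k.*2.+1 = E.
Proof.
move=> E0 Epos e1 eN.
have rowE2 (i : 'I_m.+1) : (0 < i)%N -> row i (E *m E) = e i ^+ 2 *: row i 1%:M.
  move=> i0; have lei : (i <= m)%N by rewrite -ltnS.
  apply/rowP => j; rewrite !mxE (bigD1 i) //= {1}(Epos i) // eqxx.
  rewrite gtn_eqF // addr0 mulr1n.
  have [d3i | nd3i] := boolP (3 %| i)%N; last first.
    rewrite big1 => [|l ne_li]; last first.
      by rewrite Epos // (negPf ne_li) (negPf nd3i) andbF addr0 mul0r.
    by rewrite Epos // (negPf nd3i) andbF !addr0 eq_sym mulr_natr mulrnAr expr2.
  have i3 : (3 <= i)%N by rewrite dvdn_leq.
  have n3 : (3 %| i.-1)%N = false by lia.
  pose i1 : 'I_m.+1 := inord i.-1.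
  have Di1 : i1 = i.-1 :> nat by rewrite inordK //; lia.
  (* Off the diagonal, row [i] meets only row [i.-1], which has no subdiagonal entry of its own. The
     entry of the square at column [i.-1] is thus [e i + e i.-1 = 0]. *)
  rewrite (bigD1 i1) /=; last by rewrite -val_eqE /= Di1; lia.
  rewrite big1 => [|l /andP[ne_li ne_li1]]; last first.
    rewrite Epos // (negPf ne_li) add0r (_ : (l.+1 == i) = false) ?mul0r //.
    by move: ne_li1; rewrite -val_eqE /= Di1; lia.
  have -> : E i i1 = 1.
    rewrite Epos // d3i -val_eqE /= Di1 prednK // eqxx.
    by rewrite ltn_eqF ?add0r // ltn_predL.
  rewrite mul1r addr0 !Epos ?Di1 //; last by lia.
  rewrite d3i n3 andbT andbF addr0 -!val_eqE /= Di1 eN // ?i0 //.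
  have -> : (j.+1 == i) = (j == i.-1 :> nat) by lia.
  rewrite [nat_of_ord i == j]eq_sym; case: (nat_of_ord j == i.-1).
    by case: (nat_of_ord j == i); rewrite ?mulr1n ?mulr0n; ring.
  by case: (nat_of_ord j == i); rewrite ?mulr1n ?mulr0n; ring.
have rowE2k (i : 'I_m.+1) : (0 < i)%N -> row i (E ^+ k.*2) = row i 1%:M.
  move=> i0; suff -> : row i (E ^+ k.*2) = e i ^+ k.*2 *: row i 1%:M.
    by rewrite e1 ?scale1r // i0 -ltnS ltn_ord.
  rewrite -muln2 mulnC !exprM; elim: k {e1} => [|k IHk].
    by rewrite !expr0 scale1r.
  rewrite exprSr [E ^+ 2]expr2 -[_ * (E * E)]/(_ *m _) row_mul IHk -scalemxAl.
  by rewrite -row_mul mul1mx rowE2 // scalerA [_ ^+ k.+1]exprSr.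
(* Column 0 of [E] vanishes, so in [E * E ^+ k.*2] the unknown row 0 of the second factor never
   contributes. *)
apply/matrixP => i j; rewrite exprS -[E in RHS]mulmx1 !mxE.
apply: eq_bigr => l _; case: (posnP l) => [l0 | l_gt0].
  by rewrite (_ : l = ord0) ?E0 ?mul0r //; apply: val_inj.
by have /rowP/(_ j) := rowE2k l l_gt0; rewrite ![row _ _ _ _]mxE => ->.
Qed.

(** A nonzero entry of the cube would need three consecutive indices, none of them divisible by
    3. *)
Lemma sparse_subdiagonal_cube (F : fieldType) (m : nat) :
  (\matrix_(i, j) ((j.+1 == i) && ~~ (3 %| i)%N)%:R : 'M[F]_m.+1) ^+ 3 = 0.
Proof.
apply/matrixP => i j; rewrite !exprS expr0 mulr1 !mxE big1 // => k _.
rewrite !mxE mulr_sumr big1 // => l _; rewrite !mxE -!natrM !mulnb.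
case: andP => // -[/andP[/eqP ki ?] /andP[/andP[/eqP lk ?]]].
by case/andP=> /eqP jl ?; lia.
Qed.

Lemma invmx_conj_expr (F : fieldType) (m k : nat) (P B : 'M[F]_m.+1) :
  P \in unitmx -> (invmx P *m B *m P) ^+ k = invmx P *m B ^+ k *m P.
Proof.
move=> uP; elim: k => [|k IHk]; first by rewrite !expr0 mulmx1 mulVmx.
rewrite exprS IHk [B ^+ k.+1]exprS -[LHS]/(_ *m _) -[B * _]/(_ *m _) !mulmxA.
by rewrite -[_ *m P *m invmx P]mulmxA mulmxV // mulmx1.
Qed.

(** * Choice of the scalar and of the diagonal *)

Lemma two_neq0 (F : fieldType) (p : nat) :
  p \in [pchar F] -> odd p -> 2%:R != 0 :> F.
Proof.
move=> hp hodd; rewrite -(dvdn_pcharf hp); apply/negP => /(dvdn_leq (ltn0Sn 1)).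
by rewrite leqNgt odd_prime_gt2 ?(pcharf_prime hp).
Qed.

Lemma bidiagonal_spectrum (F : fieldType) (p m t : nat) :
    p \in [pchar F] -> odd p ->
  exists (lam : F) (e : nat -> F),
    [/\ lam ^+ p = lam, \sum_(j < m.+1) (lam + e j) = t%:R, e 0 = 0,
        forall j, (0 < j <= m)%N -> e j ^+ p.-1 = 1 &
        forall j, (0 < j <= m)%N -> (3 %| j)%N -> e j = - e j.-1].
Proof.
move=> hp hodd; have p_gt0 := prime_gt0 (pcharf_prime hp).
have natp n : n%:R ^+ p = n%:R :> F.
  by rewrite -(pFrobenius_autE hp) pFrobenius_aut_nat.
have zerop : 0 ^+ p = 0 :> F := natp 0.
have p1 : p.-1 = p./2.*2 by have := odd_double_half p; rewrite hodd; lia.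
have sqr1p (x : F) : x ^+ 2 = 1 -> x ^+ p.-1 = 1.
  by move=> x2; rewrite p1 -mul2n exprM x2 expr1n.
(* The blocks of size 2 are the index pairs [3k - 1], [3k]; [base] is -1 on the first index and 1 on
   the second. *)
pose base j : F := if (j %% 3 == 2)%N then -1 else 1.
have base2 j : base j ^+ 2 = 1.
  by rewrite /base; case: ifP; rewrite ?sqrrN expr1n.
have baseN j : (0 < j)%N -> (3 %| j)%N -> base j = - base j.-1.
  move=> j_gt0 d3j; have j3 : (j %% 3 == 2)%N = false by lia.
  have j13 : (j.-1 %% 3 == 2)%N by lia.
  by rewrite /base j3 j13 opprK.
case: m => [|m].
  exists t%:R, (fun j => if j == 0%N then 0 else base j).
  split => //=; last 2 first.
  - by case=> // j; rewrite andbF.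
  - by case=> // j; rewrite andbF.
  by rewrite big_ord1 addr0.
(* This is the trace without [e 1]: indices 0 and 1 contribute [lam] each, as [e 0 = 0]. Index 1
   lies in no block of size 2, so [e 1] is free to absorb the defect [x] below. *)
pose tau lam (f : nat -> F) := lam + lam + \sum_(j < m) (lam + f j.+2).
suff [lam [f [lamp f2 fN ne_tau]]] : exists (lam : F) (f : nat -> F),
    [/\ lam ^+ p = lam, forall j, f j ^+ 2 = 1,
        forall j, (2 < j <= m.+1)%N -> (3 %| j)%N -> f j = - f j.-1 &
        tau lam f != t%:R].
  pose x := t%:R - tau lam f.
  exists lam, (fun j => if j == 0%N then 0 else if j == 1%N then x else f j).
  split=> //.
  - by rewrite !big_ord_recl /= /x /tau; ring.
  - case=> [//|[_|j _]] /=; last exact: sqr1p.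
    (* Every term of [x] is fixed by Frobenius, so [x ^+ p = x], and [x] can be cancelled. *)
    have x0 : x != 0 by rewrite subr_eq0 eq_sym.
    apply: (mulfI x0); rewrite mulr1 -exprS prednK //.
    rewrite -(pFrobenius_autE hp) /x /tau !(rmorphB, rmorphD, rmorph_sum) /=.
    rewrite !pFrobenius_autE natp lamp; congr (_ - (_ + _)).
    apply: eq_bigr => j _; rewrite rmorphD /= !pFrobenius_autE lamp.
    by rewrite -[in LHS](prednK p_gt0) exprS sqr1p ?mulr1.
  by case=> [//|[//|[//|j]]] j2 d3j /=; rewrite fN.
have not_both lam lam' f f' : tau lam f != tau lam' f' ->
    tau lam f != t%:R \/ tau lam' f' != t%:R.
  by case: (eqVneq (tau lam f) t%:R) => [->|]; [right; rewrite eq_sym | left].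
have [d | nd] := boolP (p %| m.+2)%N; last first.
  have [|ne|ne] := not_both 0 1 base base.
  - rewrite -subr_eq0 -oppr_eq0 opprB.
    (* Passing from [lam = 0] to [lam = 1] adds the size [m.+2], which is nonzero in [F] here. *)
    rewrite (_ : tau 1 base = tau 0 base + m.+2%:R).
      by rewrite addrAC subrr add0r -(dvdn_pcharf hp).
    rewrite /tau !big_split /= !sumr_const card_ord mul0rn -addn2 natrD; ring.
  - by exists 0, base; split=> // j /andP[j2 _]; apply: baseN; lia.
  exists 1, base; split=> //; first exact: (natp 1%N).
  by move=> j /andP[j2 _]; apply: baseN; lia.
(* An odd prime divides neither 2 nor 4, which excludes [m = 0] and [m = 2]. *)
have m13 : m = 1%N \/ (3 <= m)%N.
  have ltp := odd_prime_gt2 hodd (pcharf_prime hp).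
  move: m d {tau not_both} => [|[|[|m]]] d; [|by left| |by right].
    by have := dvdn_leq (ltn0Sn 1) d; lia.
  have := dvdn_leq (ltn0Sn 3) d; rewrite leq_eqVlt => /orP[/eqP p4|p4].
    by rewrite p4 in hodd.
  by move: d; have -> : p = 3%N by lia.
(* The flipped index is [j0.+2]: it is 2 in size 3, where its partner 3 is absent, and otherwise 4,
   which lies in no block of size 2. *)
pose j0 : nat := if m == 1%N then 0%N else 2%N.
have ltj0 : (j0 < m)%N by rewrite /j0; case: eqP => [->|]; lia.
pose flip j := if j == j0.+2 then - base j else base j.
have [|ne|ne] := not_both 0 0 base flip.
- have flipE : tau 0 base - tau 0 flip = base j0.+2 *+ 2.
    rewrite /tau opprD addrACA subrr add0r -sumrB (bigD1 (Ordinal ltj0)) //=.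
    rewrite big1 => [|j]; first by rewrite /flip eqxx; ring.
    by rewrite -val_eqE /= /flip !eqSS => /negPf ->; rewrite subrr.
  rewrite -subr_eq0 flipE -mulr_natl mulf_neq0 ?(two_neq0 hp) //.
  by rewrite -sqrf_eq0 base2 oner_eq0.
- by exists 0, base; split=> // j /andP[j2 _]; apply: baseN; lia.
exists 0, flip; split=> //.
  by move=> j; rewrite /flip; case: ifP; rewrite ?sqrrN.
move=> j /andP[j2 lej] d3j; rewrite /flip.
have [nj nj1] : (j == j0.+2) = false /\ (j.-1 == j0.+2) = false.
  clear -m13 j2 lej d3j; rewrite /j0.
  by case: m13 => [m1|m3]; case: (m =P 1%N) => m_1;
    split; apply/negP => /eqP; lia.
by rewrite nj nj1 baseN // ltnW // ltnW.
Qed.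

(** * Conjugation back to [A] *)

Theorem theorem12 (F : fieldType) (p : nat) (hp : p \in [pchar F])
    (hodd : odd p) (m : nat) (A : 'M[F]_m.+1) (hA : nonderogatory A)
    (t : nat) (ht : (t < p)%N) (htr : \tr A = t%:R) :
  exists E V : 'M[F]_m.+1, [/\ A = E + V, E ^+ p = E & V ^+ 3 = 0].
Proof.
have [lam [e [lamp sum_e e0 e1 eN]]] := bidiagonal_spectrum m t hp hodd.
have [|P uP] := nonderogatory_hessenberg (d := fun j => lam + e j) hA.
  by rewrite htr.
set H := P *m A *m invmx P => -[H00 Hpos].
have AH : A = invmx P *m H *m P.
  by rewrite /H !mulmxA mulVmx // mul1mx mulmxKV.
clearbody H.
pose V : 'M[F]_m.+1 := \matrix_(i, j) ((j.+1 == i) && ~~ (3 %| i)%N)%:R.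
(* This is the bidiagonal part [E0]; the summand of [H] equal to its own [p]-th power is
   [lam%:M + E]. *)
pose E := H - V - lam%:M.
have p2 : p = p./2.*2.+1 by rewrite -[LHS]odd_double_half hodd.
have Ep : E ^+ p = E.
  rewrite p2; apply: (@bidiagonal_expr _ _ _ _ e) => //.
  - move=> i; rewrite !mxE; case: (posnP i) => [i0 | i_gt0].
      have -> : i = ord0 by apply: val_inj.
      by rewrite H00 e0 eqxx mulr1n /=; ring.
    rewrite Hpos // -!val_eqE /= [0%N == _]ltn_eqF // [_ == 0%N]gtn_eqF //.
    by case: eqP => [<-|_] /=; rewrite ?mulr1n ?mulr0n; ring.
  - move=> i j i_gt0; rewrite !mxE Hpos // [j == i]eq_sym.
    case: eqP => _; case: eqP => _; case: (3 %| i)%N;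
      by rewrite ?mulr1n ?mulr0n /=; ring.
  by move=> i; rewrite -[_.*2]/(p./2.*2.+1.-1) -p2; apply: e1.
have EV : A = invmx P *m (lam%:M + E) *m P + invmx P *m V *m P.
  by rewrite -mulmxDl -mulmxDr /E [lam%:M + _]addrC !addrNK.
exists (invmx P *m (lam%:M + E) *m P), (invmx P *m V *m P).
split=> //; last first.
  by rewrite invmx_conj_expr // sparse_subdiagonal_cube mulmx0 mul0mx.
have hpM : p \in [pchar 'M[F]_m.+1] by rewrite pchar_lalg.
(* Frobenius is additive on commuting matrices, and the scalar matrix commutes with [E]. *)
rewrite invmx_conj_expr // -(pFrobenius_autE hpM).
rewrite pFrobenius_autD_comm; last exact: comm_scalar_mx.
by rewrite !pFrobenius_autE Ep -rmorphXn /= lamp.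
Qed.
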